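(* Let $\lambda$ be a nonzero real number. For all $n,m\in \mathbb{N}$, \[ \sum_{k=1}^n \binom{n}{k}\frac{(-1)^{k-1}}{k^m}\binom{\lambda+k-1}{k-1} = \sum_{1\le k_1 \le k_2\le \cdots\le k_m\le n} \frac{(-1)^{k_1 -1}}{k_1 k_2 \cdots k_m} \binom{\lambda-1}{k_1 -1}, \] where the sum on the right runs over all integer tuples $(k_1,\dots,k_m)$ with $1\le k_1\le\cdots\le k_m\le n$.
   Context: For real $x$ and integer $k\ge0$, $\binom{x}{k}=\frac{x(x-1)\cdots(x-k+1)}{k!}$. *)

(* Defs.v *)
From HB Require Import structures.
From mathcomp Require Import all_boot all_order all_algebra.
From mathcomp Require Import reals.

Set Implicit Arguments.
Unset Strict Implicit.
Unset Printing Implicit Defensive.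

Import Order.TTheory GRing.Theory Num.Theory.

Local Open Scope ring_scope.

Definition gbinom (R : realType) (x : R) (k : nat) : R :=
  (\prod_(i < k) (x - i%:R)) / k`!%:R.

(* On natural arguments [gbinom] is the library's binomial coefficient, which
   is the one used for "n choose k" with n a natural number. *)
Lemma gbinom_nat (R : realType) (n k : nat) :
  gbinom (n%:R : R) k = 'C(n, k)%:R.
Proof.
have fk0 : (k`!%:R : R) != 0 by rewrite pnatr_eq0 -lt0n fact_gt0.
apply: (canLR (mulfK fk0)); rewrite -natrM bin_ffact ffact_prod natr_prod.
have [le_kn | lt_nk] := leqP k n.
  by apply: eq_bigr => i _; rewrite natrB // (leq_trans (ltnW (ltn_ord i))).
rewrite (bigD1 (Ordinal lt_nk)) //= subrr mul0r.
by rewrite (bigD1 (Ordinal lt_nk)) //= subnn mul0r.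
Qed.

(* The tuples (k_1, ..., k_m) with 1 <= k_1 <= ... <= k_m <= n; the upper bound
   n is carried by the type 'I_n.+1 of the entries. *)
Definition weakly_increasing_tuples (n m : nat) : {set m.-tuple 'I_n.+1} :=
  [set t : m.-tuple 'I_n.+1 | all (fun i : 'I_n.+1 => 1 <= i)%N t
                              & sorted (fun i j : 'I_n.+1 => i <= j)%N t].

(* The default value ord0 of [head] is only used for the empty tuple. *)
Definition first_index (n m : nat) (t : m.-tuple 'I_n.+1) : nat :=
  head ord0 t.

(* Main.v *)
(** Write [A n m] for the left-hand side.  Pascal's rule and
    [k * 'C(n, k) = n * 'C(n-1, k-1)] give [A n m - A (n-1) m = A n (m-1) / n],
    that is [A n m = \sum_(1 <= j <= n) A j (m-1) / j], which is also the
    recursion satisfied by the right-hand side when its tuples are split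
    according to their largest entry.  The recursion is started at [m = 0], where
    the right-hand side is read as [(-1)^(n-1) * binom(lambda-1, n-1)] and the
    identity is Vandermonde's convolution after reflecting the upper arguments. *)

Require Import Defs.
From HB Require Import structures.
From mathcomp Require Import all_boot all_order all_algebra.
From mathcomp Require Import reals.
From mathcomp Require Import ring.

Set Implicit Arguments.
Unset Strict Implicit.
Unset Printing Implicit Defensive.

Import Order.TTheory GRing.Theory Num.Theory.

Local Open Scope ring_scope.

Lemma gbinom0 (R : realType) (x : R) : gbinom x 0 = 1.
Proof. by rewrite /gbinom big_ord0 fact0 divr1. Qed.

Lemma gbinomS (R : realType) (x : R) (k : nat) :
  gbinom (x + 1) k.+1 = gbinom x k + gbinom x k.+1.
Proof.
rewrite /gbinom [in LHS]big_ord_recl [in RHS]big_ord_recr /= subr0.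
under eq_bigr => i _ do rewrite /bump /= add1n mulrSr opprD addrACA subrr addr0.
have fk0 : (k`!%:R : R) != 0 by rewrite pnatr_eq0 -lt0n fact_gt0.
have k0 : (k.+1%:R : R) != 0 by rewrite pnatr_eq0.
rewrite factS natrM; move: k0; rewrite mulrSr => k0.
by field; rewrite fk0 k0.
Qed.

Lemma gbinomN (R : realType) (x : R) (k : nat) :
  gbinom (- x) k = (-1) ^+ k * gbinom (x + k%:R - 1) k.
Proof.
rewrite /gbinom mulrA; congr (_ / _).
rewrite -[in (-1) ^+ k](card_ord k) -prodrN (reindex_inj rev_ord_inj) /=.
apply: eq_bigr => i _.
by rewrite natrB // mulrSr; ring.
Qed.

Lemma sum_binS (F : comNzRingType) (h : nat -> F) (n : nat) :
  \sum_(k < n.+2) 'C(n.+1, k)%:R * h k =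
  \sum_(k < n.+1) 'C(n, k)%:R * (h k + h k.+1).
Proof.
rewrite big_ord_recl bin0.
under eq_bigr => i _ do rewrite lift0 binS natrD mulrDl.
rewrite big_split /= big_ord_recr /= bin_small // mul0r addr0.
under [RHS]eq_bigr => i _ do rewrite mulrDr.
rewrite [RHS]big_split /= addrA; congr (_ + _).
by rewrite [RHS]big_ord_recl bin0.
Qed.

(** Vandermonde's convolution drawn from Pascal's rule alone, so that it also applies to
    index-shifted families. Merging neighbouring terms turns the sum for [f] into a shorter one for
    [f (y + 1) k.+1], which obeys the same rule; hence [f] is generalized in the induction. *)
Lemma pascal_sum (F : comNzRingType) (f : F -> nat -> F) :
  (forall x k, f (x + 1) k.+1 = f x k + f x k.+1) ->
  forall n x, \sum_(k < n.+1) 'C(n, k)%:R * f x k = f (x + n%:R) n.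
Proof.
move=> fS n; elim: n f fS => [|n IHn] f fS x.
  by rewrite big_ord_recl big_ord0 bin0 mul1r !addr0.
rewrite sum_binS; under eq_bigr => k _ do rewrite -fS.
rewrite (IHn (fun y k => f (y + 1) k.+1)) => [|y k]; last exact: fS.
by rewrite mulrSr addrA.
Qed.

Lemma sum_bin_gbinom (R : realType) (x : R) (n : nat) : (0 < n)%N ->
  \sum_(1 <= k < n.+1)
     'C(n, k)%:R * ((-1) ^+ (k - 1) * gbinom (x + k%:R - 1) (k - 1))
  = (-1) ^+ (n - 1) * gbinom (x - 1) (n - 1).
Proof.
move=> n0.
(* The value 0 at index 0 keeps Pascal's rule true for the shifted family and supplies the missing
   term [k = 0]. *)
pose f (y : R) k := if k is k'.+1 then gbinom y k' else 0.
have fS y k : f (y + 1) k.+1 = f y k + f y k.+1.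
  by case: k => [|k] /=; rewrite ?gbinomS // !gbinom0 add0r.
(* At [- (x + 1)], reflection gives exactly the signed coefficients of the left-hand side. *)
transitivity (\sum_(k < n.+1) 'C(n, k)%:R * f (- (x + 1)) k).
  rewrite -(big_mkord xpredT (fun k => 'C(n, k)%:R * f (- (x + 1)) k)).
  rewrite [RHS]big_ltn // mulr0 add0r; apply: eq_big_nat => -[//|k] _ /=.
  by rewrite subn1 /= gbinomN; congr (_ * (_ * gbinom _ _)); ring.
rewrite (pascal_sum fS); case: n n0 => // n _ /=.
have -> : - (x + 1) + n.+1%:R = - (x - n%:R) by ring.
by rewrite gbinomN subn1 subrK.
Qed.

Lemma sum_bin_expS (F : numFieldType) (a : nat -> F) (n m : nat) :
  \sum_(1 <= k < n.+1) 'C(n, k)%:R * (a k / k%:R ^+ m.+1) =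
  \sum_(1 <= j < n.+1)
     (\sum_(1 <= k < j.+1) 'C(j, k)%:R * (a k / k%:R ^+ m)) / j%:R.
Proof.
elim: n => [|n IHn]; first by rewrite !big_geq.
rewrite [RHS]big_nat_recr //= -IHn.
(* As ['C(n, n.+1)] vanishes, both sums get the same range and can be compared term by term. *)
have -> : \sum_(1 <= k < n.+1) 'C(n, k)%:R * (a k / k%:R ^+ m.+1) =
          \sum_(1 <= k < n.+2) 'C(n, k)%:R * (a k / k%:R ^+ m.+1).
  by rewrite [RHS]big_nat_recr //= bin_small // mul0r addr0.
rewrite mulr_suml -big_split /=; apply: eq_big_nat => -[//|k] _.
have n0 : (n.+1%:R : F) != 0 by rewrite pnatr_eq0.
have k0 : (k.+1%:R : F) != 0 by rewrite pnatr_eq0.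
have binE : 'C(n.+1, k.+1)%:R = n.+1%:R * 'C(n, k)%:R / k.+1%:R :> F.
  by apply: (canRL (mulfK k0)); rewrite -!natrM mul_bin_diag mulnC.
rewrite {2}binE binS natrD mulrDl exprS; congr (_ + _).
by field; rewrite !nat1r n0 k0 expf_neq0.
Qed.

(* The chains n >= k_m >= ... >= k_1 >= 1 are listed downwards, so that the
   empty chain contributes [b n]. *)
Definition chain_sum (F : fieldType) (b : nat -> F) (N m n : nat) : F :=
  \sum_(t : m.-tuple 'I_N.+1 |
          path (fun i j => 0 < j <= i)%N n [seq val i | i <- t])
     b (last n [seq val i | i <- t]) / \prod_(i <- t) (i : nat)%:R.

Lemma chain_sum0 (F : fieldType) (b : nat -> F) (N n : nat) :
  chain_sum b N 0 n = b n.
Proof.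
rewrite /chain_sum (big_pred1 [tuple]) => [|t]; last by rewrite !tuple0 /= eqxx.
by rewrite big_nil divr1.
Qed.

(** The head [j] of a chain is its largest entry, and the rest is a chain below [j]. Keeping [N]
    fixed lets the bound vary without changing the type of the entries; [n <= N] ensures that every
    [j <= n] occurs in it. *)
Lemma chain_sumS (F : fieldType) (b : nat -> F) (N m n : nat) : (n <= N)%N ->
  chain_sum b N m.+1 n = \sum_(1 <= j < n.+1) chain_sum b N m j / j%:R.
Proof.
move=> le_nN.
pose cns (p : 'I_N.+1 * m.-tuple 'I_N.+1) := [tuple of p.1 :: p.2].
have cns_bij : bijective cns.
  exists (fun t => (thead t, [tuple of behead t])) => [[i t]|t] /=.
    by rewrite /cns theadE; congr (_, _); apply: val_inj.
  by rewrite /cns -tuple_eta.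
rewrite /chain_sum (reindex cns) /=; last exact: onW_bij.
rewrite -(pair_big_dep (fun i : 'I_N.+1 => 0 < i <= n)%N
  (fun i (t : m.-tuple 'I_N.+1) =>
     path (fun i j => 0 < j <= i)%N (i : nat) [seq val i | i <- t])
  (fun i t => b (last (i : nat) [seq val i | i <- t]) /
     \prod_(j <- (i :: t)) (j : nat)%:R)) /=.
rewrite (big_nat_widen _ _ N.+1) // (big_nat_widenl 1 0) //.
rewrite big_mkord; apply: eq_big => [i|i _].
  by rewrite /= ltnS andbC.
rewrite mulr_suml; apply: eq_bigr => t _.
by rewrite big_cons invfM mulrCA mulrC.
Qed.

(** By transitivity, bounding the head by [n] bounds all entries. *)
Lemma path_chainE (N n : nat) (s : seq 'I_N.+1) :
  path (fun i j => 0 < j <= i)%N n [seq val i | i <- s] =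
  [&& all (fun i : 'I_N.+1 => i <= n)%N s, all (fun i : 'I_N.+1 => 1 <= i)%N s
    & sorted (fun i j : 'I_N.+1 => i <= j)%N (rev s)].
Proof.
have -> : sorted (fun i j : 'I_N.+1 => i <= j)%N (rev s) =
          sorted (fun i j => j <= i)%N [seq val i | i <- s].
  by rewrite rev_sorted sorted_map.
have -> : all (fun i : 'I_N.+1 => i <= n)%N s =
          all (fun i => i <= n)%N [seq val i | i <- s] by rewrite all_map.
have -> : all (fun i : 'I_N.+1 => 1 <= i)%N s =
          all (fun i => 1 <= i)%N [seq val i | i <- s] by rewrite all_map.
elim: {s}(map _ s) n => //= k s IHs n.
rewrite IHs (path_sortedE (fun y x z => fun xy yz => leq_trans yz xy)).
have [le_kn|] := leqP k n; last by rewrite andbF.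
have [/allP le_sk|] := boolP (all (fun i => i <= k)%N s); last by rewrite !andbF.
rewrite (_ : all (fun i => i <= n)%N s) ?andbT //=; first by rewrite andbA.
by apply/allP => i /le_sk /leq_trans; apply.
Qed.

(** Reversal of tuples matches the two index sets and turns the first entry into the last. For
    [m = 0] the sides may differ: [first_index] defaults to 0, whereas the empty chain gives
    [b n]. *)
Lemma sum_weakly_increasing_tuples (F : fieldType) (b : nat -> F) (n m : nat) :
  (0 < m)%N ->
  \sum_(t in weakly_increasing_tuples n m)
     b (first_index t) / \prod_(i < m) (tnth t i : nat)%:R = chain_sum b n m n.
Proof.
move=> m0; rewrite /chain_sum.
have rev_inj : injective (fun t : m.-tuple 'I_n.+1 => [tuple of rev t]).
  by move=> t u /(congr1 val) /= /(can_inj revK) /val_inj.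
rewrite (reindex_inj rev_inj) /=; apply: eq_big => [t|t _].
  have le_tn : all (fun i : 'I_n.+1 => i <= n)%N t.
    by apply/allP => i _; rewrite -ltnS.
  by rewrite inE path_chainE le_tn /= all_rev.
congr (b _ / _).
  rewrite /first_index /=; move: (size_tuple t) m0.
  case/lastP: (tval t) => [<- //|s x] _ _.
  by rewrite rev_rcons map_rcons last_rcons.
rewrite -(big_tuple _ _ [tuple of rev t] xpredT (fun i => (i : nat)%:R)) /=.
by apply: perm_big; rewrite perm_rev.
Qed.

Theorem theorem2p6 (R : realType) (lambda : R) (hlambda : lambda != 0)
    (n m : nat) (hn : (0 < n)%N) (hm : (0 < m)%N) :
  \sum_(1 <= k < n.+1)
     'C(n, k)%:R * ((-1) ^+ (k - 1) / k%:R ^+ m)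
       * gbinom (lambda + k%:R - 1) (k - 1)
  = \sum_(t in weakly_increasing_tuples n m)
     ((-1) ^+ (first_index t - 1) / \prod_(i < m) (tnth t i : nat)%:R)
       * gbinom (lambda - 1) (first_index t - 1).
Proof.
pose a k : R := (-1) ^+ (k - 1) * gbinom (lambda + k%:R - 1) (k - 1).
pose b k : R := (-1) ^+ (k - 1) * gbinom (lambda - 1) (k - 1).
under eq_bigr => k _ do rewrite -mulrA mulrAC.
under [RHS]eq_bigr => t _ do rewrite mulrAC.
rewrite (sum_weakly_increasing_tuples b) //.
(* The bound [j] varies while the entries stay in ['I_n.+1]. In terms of chains the claim makes
   sense at [m = 0], where the induction starts. *)
suff: forall j, (0 < j <= n)%N ->
    \sum_(1 <= k < j.+1) 'C(j, k)%:R * (a k / k%:R ^+ m) = chain_sum b n m j.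
  by apply; rewrite hn leqnn.
elim: m {hm} => [|m IHm] j /andP[j0 le_jn].
  rewrite chain_sum0 -[RHS]sum_bin_gbinom //.
  by apply: eq_bigr => k _; rewrite divr1.
rewrite sum_bin_expS chain_sumS //; apply: eq_big_nat => i /andP[i0 lt_ij].
by rewrite IHm // i0 (leq_trans _ le_jn).
Qed.
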